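(* There exist a finitely generated, residually finite group $G$ with a filtration $(M_i)$ and a normal finite index subgroup $H\lhd G$ such that the box spaces $\Box_{(M_i)}G$ and $\Box_{(M_i\cap H)}H$ are not coarsely equivalent.
   Context: Filtration: for a residually finite, finitely generated group $G$, a filtration of $G$ is a sequence $(N_i)_{i\in\mathbb{N}}$ of nested ($N_{i+1}\subseteq N_i$), normal, finite index subgroups of $G$ with $\bigcap_i N_i=\{e\}$. If $(M_i)$ is a filtration of $G$ and $H\le G$ has finite index, then $(M_i\cap H)$ is a filtration of $H$. Box space: fix a finite generating set $S$ of $G$. The box space $\Box_{(N_i)}G$ is the disjoint union $\bigsqcup_i G/N_i$, where each component $G/N_i$ carries the Cayley graph metric with respect to the image of $S$, and the distance between any two distinct components (i.e. between points of them) is the sum of their diameters. Changing the finite generating set gives a coarsely equivalent space. The box space $\Box_{(M_i\cap H)}H$ is formed using a fixed finite generating set of $H$ (not the metric induced from $G/M_i$). Coarse equivalence: a map $\varphi:X\to Y$ between metric spaces is a coarse embedding if there are proper functions $\rho_\pm:\mathbb{R}_+\to\mathbb{R}_+$ with $\rho_-(d_X(a,b))\le d_Y(\varphi(a),\varphi(b))\le\rho_+(d_X(a,b))$ for all $a,b\in X$. It is a coarse equivalence if moreover there is $C>0$ such that every $y\in Y$ is at distance at most $C$ from $\varphi(X)$. $X$ and $Y$ are coarsely equivalent if a coarse equivalence $X\to Y$ exists. *)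

(* Defs.v *)
From HB Require Import structures.
From mathcomp Require Import all_boot all_order all_algebra.
From mathcomp Require Import all_classical all_reals all_analysis.
Set Implicit Arguments.
Unset Strict Implicit.
Unset Printing Implicit Defensive.

Import Order.TTheory GRing.Theory Num.Theory.
Import numFieldNormedType.Exports.

Local Open Scope classical_set_scope.
Local Open Scope ring_scope.
Local Open Scope quotient_scope.

(** * Subgroups, quotients, residual finiteness

    Groups are [groupType]s (possibly infinite); a subgroup of [G] is an element
    of [groupClosed G], i.e. a predicate containing 1 and closed under product
    and inverse. *)

Section Subgroups.
Variable G : groupType.
Implicit Types N H : groupClosed G.

Definition lcoset_rel N : rel G := fun x y => (x^-1 * y)%g \in N.

Lemma lcoset_rel_equiv N : equiv_class_of (lcoset_rel N).
Proof.
split=> [x|x y|y x z]; rewrite /lcoset_rel.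
- by rewrite mulVg gpred1.
- by rewrite -gpredV invgM invgK.
- move=> xy yz; rewrite (_ : (x^-1 * z)%g = ((x^-1 * y) * (y^-1 * z))%g).
    exact: gpredM.
  by rewrite mulgA mulgK.
Qed.

Canonical lcoset_equiv_rel N := EquivRelPack (lcoset_rel_equiv N).

(* G / N, as the type of left cosets; [quot_pi N g] is the coset g N. *)
Definition quot N := {eq_quot (lcoset_rel N)}.
HB.instance Definition _ N := Choice.on (quot N).
HB.instance Definition _ N := EqQuotient.on (quot N).

Definition quot_pi N (g : G) : quot N := \pi_(quot N) g.

Definition normal_subgroup N := forall x g : G, x \in N -> (x ^ g)%g \in N.

Definition finite_index N := finite_set [set: quot N].

Definition generates (S : seq G) :=
  forall K : groupClosed G, {subset S <= K} -> forall g, g \in K.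

Definition finitely_generated := exists S : seq G, generates S.

Definition residually_finite := forall g : G, g <> 1%g ->
  exists N, [/\ normal_subgroup N, finite_index N & g \notin N].

Definition filtration (N : nat -> groupClosed G) :=
  [/\ forall i, {subset N i.+1 <= N i},
      forall i, normal_subgroup (N i),
      forall i, finite_index (N i) &
      forall g, (forall i, g \in N i) -> g = 1%g].

Definition subgroup H := {x : G | x \in H}.
HB.instance Definition _ H := SubChoice.on (subgroup H).

Fact subgroup_closed H : group_closed H.
Proof. by split=> [|x y Hx Hy]; [exact: gpred1 | exact: gpredF]. Qed.

HB.instance Definition _ H :=
  SubChoice_isSubGroup.Build G (mem H) (subgroup H) (subgroup_closed H).

(* The subgroup N :&: H of H. *)
Section CapSubgroup.
Variables N H : groupClosed G.

Definition cap_subgroup : {pred subgroup H} := fun x => val x \in N.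

Lemma cap_subgroupE x : (x \in cap_subgroup) = (val x \in N).
Proof. by []. Qed.

Fact cap_subgroup1 : 1%g \in cap_subgroup.
Proof. by rewrite cap_subgroupE val1 gpred1. Qed.

Fact cap_subgroupM : mulg_closed cap_subgroup.
Proof. by move=> x y; rewrite !cap_subgroupE valM; apply: gpredM. Qed.

Fact cap_subgroupV : invg_closed cap_subgroup.
Proof. by move=> x; rewrite !cap_subgroupE gmulfV; apply: gpredVr. Qed.

HB.instance Definition _ := isMulClosed.Build _ cap_subgroup cap_subgroupM.
HB.instance Definition _ := isMul1Closed.Build _ cap_subgroup cap_subgroup1.
HB.instance Definition _ := isInvClosed.Build _ cap_subgroup cap_subgroupV.
End CapSubgroup.

Arguments cap_subgroup N H _ : clear implicits.

Definition cap_filtration (M : nat -> groupClosed G) H :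
  nat -> groupClosed (subgroup H) := fun i => cap_subgroup (M i) H.

End Subgroups.

(** * Box spaces *)

Section Distances.
Variable R : realType.

(* Path metric of the undirected graph with edge relation [e]; it is only
   meaningful when the graph is connected, since [inf set0 = 0]. *)
Definition graph_dist (V : eqType) (e : rel V) (x y : V) : R :=
  inf [set (size p)%:R | p in [set p : seq V | path e x p /\ last x p = y]].

Definition diameter (V : Type) (d : V -> V -> R) : R :=
  sup [set d xy.1 xy.2 | xy in [set: V * V]].

End Distances.

Section BoxSpace.
Variables (G : groupType) (S : seq G).

(* Cayley graph of G / N (N normal) with respect to the image of S: an edge
   joins the cosets g N and (g s) N = (g N) (s N), for g in G and s in S. *)
Definition cayley_rel (N : groupClosed G) : rel (quot N) := fun x y =>
  `[< exists2 s, s \in S & exists g : G,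
        (x = quot_pi N g /\ y = quot_pi N (g * s)%g) \/
        (y = quot_pi N g /\ x = quot_pi N (g * s)%g) >].

Variables (R : realType) (N : nat -> groupClosed G).

Definition box_space := {i : nat & quot (N i)}.

Definition cayley_dist (i : nat) : quot (N i) -> quot (N i) -> R :=
  graph_dist R (@cayley_rel (N i)).

(* [tagged_as x y] is the second component of y, cast to the component of x. *)
Definition box_dist (x y : box_space) : R :=
  if tag x == tag y then cayley_dist (tagged x) (tagged_as x y)
  else diameter (@cayley_dist (tag x)) + diameter (@cayley_dist (tag y)).

End BoxSpace.

Arguments box_dist {G} S R N x y.

(** * Coarse equivalence

    Spaces are given by a type and a distance function, not by a [metricType]:
    two one-point components of a box space are at distance 0. *)

Section Coarse.
Variable R : realType.

(* Proper functions from the nonnegative reals to themselves, in the sense of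
   coarse geometry: preimages of bounded sets are bounded. *)
Definition proper_nneg (rho : R -> R) :=
  (forall t, 0 <= t -> 0 <= rho t) /\
  (forall B : set R, bounded_set B ->
     bounded_set [set t | 0 <= t /\ B (rho t)]).

Variables (X Y : Type) (dX : X -> X -> R) (dY : Y -> Y -> R).

Definition coarse_embedding (phi : X -> Y) :=
  exists rho_minus rho_plus : R -> R,
    [/\ proper_nneg rho_minus, proper_nneg rho_plus &
        forall a b, rho_minus (dX a b) <= dY (phi a) (phi b) <= rho_plus (dX a b)].

Definition coarse_equivalence (phi : X -> Y) :=
  coarse_embedding phi /\
  exists2 C : R, 0 < C & forall y, exists x, dY y (phi x) <= C.

Definition coarsely_equivalent := exists phi : X -> Y, coarse_equivalence phi.

End Coarse.

(* Main.v *)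
(* Let G be the integer Heisenberg group, M_i its congruence subgroup modulo
   q = 3^i and H the subgroup of index 2 on which the (1,2) entry is even.
   For large i the Z/2-valued 1-cocycles on G/M_i at a fixed large scale, modulo
   coboundaries, are the homomorphisms M_i -> Z/2. There are at most 4 of these,
   since z^(q^2) = [x^q, y^q] and q is odd force z^q to be killed, whereas
   M_j /\ H has 8, the commutators of its generators being even powers of z^q.
   A coarse equivalence maps a large component of one box space to a large
   component of the other, and pulling back 1-cocycles along it is injective on
   coarse cohomology classes because it has a quasi-inverse. *)
Require Import Defs.
From HB Require Import structures.
From mathcomp Require Import all_boot all_order all_algebra.
From mathcomp Require Import all_classical all_reals all_analysis.
From mathcomp Require Import zify ring.
Set Implicit Arguments.
Unset Strict Implicit.
Unset Printing Implicit Defensive.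

Import Order.TTheory GRing.Theory Num.Theory.
Local Open Scope classical_set_scope.
Local Open Scope ring_scope.
Local Open Scope quotient_scope.

(** * Induction over a generating set *)

Lemma generates_ind (G : groupType) (S : seq G) (P : G -> Prop) :
  generates S -> P 1%g -> (forall x y, P x -> P y -> P (x * y)%g) ->
  (forall x, P x -> P x^-1%g) -> (forall s, s \in S -> P s) -> forall g, P g.
Proof.
move=> gS P1 PM PV PS g.
pose Q : {pred G} := fun x => `[< P x >].
have QM : mulg_closed Q.
  by move=> x y /asboolP Px /asboolP Py; apply/asboolP; exact: PM.
have Q1 : 1%g \in Q by apply/asboolP.
have QV : invg_closed Q by move=> x /asboolP Px; apply/asboolP; exact: PV.
pose K : groupClosed G := HB.pack Q (isMulClosed.Build _ Q QM)
  (isMul1Closed.Build _ Q Q1) (isInvClosed.Build _ Q QV).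
apply/asboolP; apply: (gS K) => s /PS Ps; exact/asboolP.
Qed.

Lemma generates_invariant (G : groupType) (S : seq G) (T : Type) (W : G -> T) :
  generates S -> (forall g s, s \in S -> W (g * s)%g = W g) ->
  forall g, W g = W 1%g.
Proof.
(* The base point 1 is generalized to [h], because the product and inverse cases of the induction
   move it. *)
move=> gS WS g; rewrite -[g]mul1g; move: (1%g : G) => h.
move: g h; apply: (generates_ind gS) => [h|x y Wx Wy h|x Wx h|s sS h].
- by rewrite mulg1.
- by rewrite mulgA Wy.
- by rewrite -[in RHS](mulgVK x h) Wx.
- exact: WS.
Qed.

(** * Word balls, cosets and Cayley distances *)

Section Balls.
Variables (G : groupType) (S : seq G).

(** The identity counts as a letter, so that words of length [n] fill a ball instead of a sphere and
    the balls are nested. *)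
Definition letters : seq G := 1%g :: S ++ [seq s^-1%g | s <- S].

Fixpoint wball (n : nat) : seq G :=
  if n is m.+1 then [seq (b * s)%g | b <- wball m, s <- letters] else [:: 1%g].

Lemma wballSP n g : reflect
  (exists b s, [/\ b \in wball n, s \in letters & g = (b * s)%g])
  (g \in wball n.+1).
Proof.
apply: (iffP allpairsP) => [[[b s] /= [? ? ->]]|[b [s [? ? ->]]]].
  by exists b, s.
by exists (b, s).
Qed.

Lemma letters1 : 1%g \in letters. Proof. exact: mem_head. Qed.

Lemma lettersV s : s \in letters -> s^-1%g \in letters.
Proof.
rewrite !inE !mem_cat => /predU1P[->|]; first by rewrite invg1 eqxx.
case/orP=> [sS|/mapP[t tS ->]]; last by rewrite invgK tS !orbT.
by rewrite (map_f _ sS) !orbT.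
Qed.

Lemma mem_letters s : s \in S -> s \in letters.
Proof. by rewrite inE mem_cat => ->; rewrite orbT. Qed.

Lemma wball_letters s : s \in letters -> s \in wball 1.
Proof. by move=> sS; apply/wballSP; exists 1%g, s; rewrite mul1g mem_head. Qed.

Lemma wballM m n b c : b \in wball m -> c \in wball n -> (b * c)%g \in wball (m + n).
Proof.
move=> bm; elim: n c => [|n IH] c; first by rewrite inE => /eqP->; rewrite mulg1 addn0.
case/wballSP=> [d [s [dn sS ->]]]; rewrite addnS; apply/wballSP.
by exists (b * d)%g, s; rewrite mulgA IH.
Qed.

Lemma wballV n b : b \in wball n -> b^-1%g \in wball n.
Proof.
elim: n b => [|n IH] b; first by rewrite !inE => /eqP->; rewrite invg1.
case/wballSP=> [d [s [dn sS ->]]]; rewrite invgM -add1n.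
by apply: wballM (IH _ dn); apply/wball_letters/lettersV.
Qed.

Lemma wball1 n : 1%g \in wball n.
Proof.
elim: n => [|n IH]; first exact: mem_head.
by apply/wballSP; exists 1%g, 1%g; rewrite IH letters1 mulg1.
Qed.

Lemma sub_wball m n : (m <= n)%N -> {subset wball m <= wball n}.
Proof.
move=> /subnKC<- b bm; rewrite -[b]mulg1; exact: wballM bm (wball1 _).
Qed.

Lemma wball_exhaust g : generates S -> exists n, g \in wball n.
Proof.
move=> gS; move: g; apply: (generates_ind gS) => [|x y [m xm] [n yn]|x [n xn]|s sS].
- by exists 0; exact: mem_head.
- by exists (m + n)%N; exact: wballM.
- by exists n; exact: wballV.
- by exists 1; exact/wball_letters/mem_letters.
Qed.

Lemma wball_exhaust_seq (F : seq G) :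
  generates S -> exists n, {subset F <= wball n}.
Proof.
move=> gS; elim: F => [|g F [n Fn]]; first by exists 0.
have [m gm] := wball_exhaust g gS; exists (maxn m n) => x /predU1P[->|/Fn].
  exact: (sub_wball (leq_maxl _ _)).
exact: (sub_wball (leq_maxr _ _)).
Qed.

End Balls.

Arguments wball : simpl never.

Section Quotients.
Variables (G : groupType) (N : groupClosed G).

Lemma quot_piP g h : quot_pi N g = quot_pi N h <-> (g^-1 * h)%g \in N.
Proof. by split=> [/eqmodP|Ngh]; last apply/eqmodP. Qed.

Lemma quot_pi_repr (x : quot N) : quot_pi N (repr x) = x.
Proof. exact: reprK. Qed.

Lemma quot_piW (P : quot N -> Prop) :
  (forall g, P (quot_pi N g)) -> forall x, P x.
Proof. by move=> Ppi x; rewrite -(quot_pi_repr x). Qed.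

Hypothesis nN : normal_subgroup N.

Lemma normalJ n g : n \in N -> (g * n * g^-1)%g \in N.
Proof. by move=> /(nN g^-1%g); rewrite /conjg invgK mulgA. Qed.

Lemma quot_piMl n g : n \in N -> quot_pi N (n * g)%g = quot_pi N g.
Proof.
move=> Nn; apply/quot_piP; rewrite invgM -mulgA.
by have := nN g (gpredVr _ Nn); rewrite /conjg.
Qed.

(** Cosets are left cosets, but by normality two representatives also differ by a factor on the
    left, which commutes with the right multiplications along edges. *)
Lemma quot_pi_lift g h :
  quot_pi N g = quot_pi N h -> exists2 n, n \in N & h = (n * g)%g.
Proof.
move=> /quot_piP Ngh; exists (h * g^-1)%g; last by rewrite mulgVK.
by have := normalJ g Ngh; rewrite mulgA mulgV mul1g.
Qed.

Lemma quot_piMr g h k :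
  quot_pi N g = quot_pi N h -> quot_pi N (g * k)%g = quot_pi N (h * k)%g.
Proof.
case/quot_pi_lift=> n Nn ->.
rewrite -mulgA.
by rewrite (quot_piMl _ Nn). Qed.

Lemma quot_pi_cancel g b c :
  quot_pi N (g * b)%g = quot_pi N (g * c)%g -> (b^-1 * c)%g \in N.
Proof. by move=> /quot_piP; rewrite invgM -mulgA mulKg. Qed.

End Quotients.

Definition infinite_group (G : groupType) := forall F : seq G, exists g, g \notin F.

(** A nontrivial element of [F] leaves some term of the filtration and, by nestedness, all later
    ones; [F] is finite, so one index serves all its elements. *)
Lemma filtration_eventually (G : groupType) (N : nat -> groupClosed G) (F : seq G) :
  filtration N -> exists i0, forall i, (i0 <= i)%N ->
    forall g, g \in F -> g \in N i -> g = 1%g.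
Proof.
case=> decN _ _ trN.
have decN' i j : (i <= j)%N -> {subset N j <= N i}.
  elim: j => [|j IH]; first by rewrite leqn0 => /eqP->.
  by rewrite leq_eqVlt => /predU1P[->//|/IH sub] g /decN /sub.
elim: F => [|f F [i0 IH]]; first by exists 0.
have [->|f1] := eqVneq f 1%g.
  by exists i0 => i i0i g /predU1P[->//|gF]; exact: IH gF.
have [j fNj] : exists j, f \notin N j.
  apply: contra_notP (elimN eqP f1) => nex; apply: trN => i.
  by apply: contra_notT nex => ?; exists i.
exists (maxn i0 j) => i; rewrite geq_max => /andP[i0i ji] g.
move=> /predU1P[->|gF]; last exact: IH gF.
by move=> /(decN' _ _ ji); rewrite (negPf fNj).
Qed.

Section Distance.
Variables (R : realType) (V : eqType) (e : rel V).

Lemma inf_nat (P : nat -> Prop) : (exists n, P n) ->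
  exists2 n, P n & inf [set n%:R | n in P] = n%:R :> R.
Proof.
move=> exP; have exb : exists n, `[< P n >].
  by case: exP => n Pn; exists n; apply/asboolP.
case: (ex_minnP exb) => m /asboolP Pm minm; exists m => //.
apply/eqP; rewrite eq_le; apply/andP; split.
  apply: ge_inf; last by exists m.
  by exists 0 => _ [n _ <-].
apply: lb_le_inf; first by exists m%:R, m.
by move=> _ [n Pn <-]; rewrite ler_nat minm //; apply/asboolP.
Qed.

Lemma graph_distP (x y : V) :
  (exists p, path e x p /\ last x p = y) ->
  exists2 n, graph_dist R e x y = n%:R &
    (exists p, [/\ path e x p, last x p = y & size p = n]) /\
    (forall p, path e x p -> last x p = y -> (n <= size p)%N).
Proof.
move=> [p0 [ep0 lp0]].
pose P n := exists p, [/\ path e x p, last x p = y & size p = n].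
have exP : exists n, P n by exists (size p0), p0.
have -> : graph_dist R e x y = inf [set n%:R | n in P].
  rewrite /graph_dist; congr inf; apply/seteqP; split=> _ [z zP <-].
    by exists (size z) => //; exists z; case: zP.
  by case: zP => p [? ? <-]; exists p.
have [n Pn infn] := inf_nat exP; exists n => //; split=> // p ep lp.
rewrite -(ler_nat R) -infn; apply: ge_inf; first by exists 0 => _ [k _ <-].
by exists (size p) => //; exists p.
Qed.

End Distance.

Section Cayley.
Variables (G : groupType) (S : seq G) (N : groupClosed G).
Hypothesis nN : normal_subgroup N.

(** Closeness at the scale of a finite list, which need not be a word ball. Quantifying over all
    representatives avoids a choice; for normal [N] one representative suffices, by [qcloseP]. *)
Definition qclose (F : seq G) (x y : quot N) :=
  forall g, x = quot_pi N g -> exists2 b, b \in F & y = quot_pi N (g * b)%g.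

Lemma qcloseP F g y : qclose F (quot_pi N g) y <->
  exists2 b, b \in F & y = quot_pi N (g * b)%g.
Proof.
split=> [/(_ g erefl)//|[b bF yE] h hE]; exists b => //.
by rewrite yE; exact: quot_piMr.
Qed.

Lemma qclose_pi F g b : b \in F -> qclose F (quot_pi N g) (quot_pi N (g * b)%g).
Proof. by move=> bF; apply/qcloseP; exists b. Qed.

Lemma sub_qclose F F' x y : {subset F <= F'} -> qclose F x y -> qclose F' x y.
Proof. by move=> sF xy g /xy[b bF ->]; exists b; first exact: sF. Qed.

Lemma qclose_wball_sym n x y : qclose (wball S n) x y -> qclose (wball S n) y x.
Proof.
elim/quot_piW: x => g /qcloseP[b bn ->]; apply/qcloseP.
by exists b^-1%g; rewrite ?wballV// mulgK.
Qed.

Lemma qclose_wball_trans m n x y z :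
  qclose (wball S m) x y -> qclose (wball S n) y z -> qclose (wball S (m + n)) x z.
Proof.
elim/quot_piW: x => g /qcloseP[b bn ->] /qcloseP[c cn ->]; apply/qcloseP.
by exists (b * c)%g; rewrite ?wballM// mulgA.
Qed.

Lemma cayley_path_qclose x p : path (@cayley_rel G S N) x p ->
  qclose (wball S (size p)) x (last x p).
Proof.
elim: p x => [|y p IH] x /=.
  elim/quot_piW: x => g _; apply/qcloseP; exists 1%g; rewrite ?mulg1 ?mem_head//.
case/andP=> /asboolP[s sS [g xy]] /IH yz; rewrite -add1n.
apply: qclose_wball_trans yz; case: xy => -[-> ->].
  by apply/qclose_pi/wball_letters/mem_letters.
by apply/qclose_wball_sym/qclose_pi/wball_letters/mem_letters.
Qed.

Lemma qclose_cayley_path n x y : qclose (wball S n) x y ->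
  exists p, [/\ path (@cayley_rel G S N) x p, last x p = y & (size p <= n)%N].
Proof.
elim/quot_piW: x => g /qcloseP[b + ->] {y}.
elim: n b => [b|n IH _ /wballSP[b [s [/IH[p [pp lp sp]] sS ->]]]].
  by rewrite inE => /eqP->; exists [::]; rewrite mulg1.
move: sS; rewrite inE mem_cat => /predU1P[->|sS].
  by exists p; rewrite mulg1; split=> //; exact: leqW.
exists (rcons p (quot_pi N (g * (b * s))%g)).
rewrite rcons_path last_rcons size_rcons pp lp; split=> //=; apply/asboolP.
case/orP: sS => [sS|/mapP[t tS ->]].
  by exists s => //; exists (g * b)%g; left; rewrite mulgA.
by exists t => //; exists (g * (b * t^-1))%g; right; rewrite -!mulgA mulVg mulg1.
Qed.

End Cayley.

Section CayleyDist.
Variables (R : realType) (G : groupType) (S : seq G) (N : nat -> groupClosed G).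
Variable i : nat.
Hypotheses (gS : generates S) (nN : normal_subgroup (N i)).

(** Paths and words correspond letter by letter, the letter 1 giving no edge, so the length of a
    shortest path is the least radius of a ball that joins the cosets. *)
Lemma cayley_dist_nat (x y : quot (N i)) : exists2 n, cayley_dist S R x y = n%:R :> R &
  forall m, qclose (wball S m) x y <-> (n <= m)%N.
Proof.
have [m xy] :
    exists m, qclose (wball S m) x y.
  elim/quot_piW: x => g; elim/quot_piW: y => h.
  have [m gh] := wball_exhaust (g^-1 * h)%g gS.
  by exists m; apply/(qcloseP nN); exists (g^-1 * h)%g; rewrite ?mulVKg.
rewrite /cayley_dist.
have [|n -> [[p [pp lp <-]] minp]] :=
  @graph_distP R _ (@cayley_rel G S (N i)) x y.
  by have [p [? ? _]] := qclose_cayley_path nN xy; exists p.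
exists (size p) => // k; split=> [/(qclose_cayley_path nN)[q [qp lq]]|pk].
  by apply: leq_trans; exact: minp.
by rewrite -lp; apply: sub_qclose (sub_wball pk) (cayley_path_qclose nN pp).
Qed.

Lemma cayley_dist_le (x y : quot (N i)) n :
  (cayley_dist S R x y <= n%:R :> R) <-> qclose (wball S n) x y.
Proof. by have [k -> ->] := cayley_dist_nat x y; rewrite ler_nat. Qed.

Lemma cayley_dist_ge0 (x y : quot (N i)) : 0 <= cayley_dist S R x y :> R.
Proof. by have [k -> _] := cayley_dist_nat x y. Qed.

Hypothesis fN : finite_index (N i).

Lemma has_sup_cayley_dist :
  has_sup [set cayley_dist S R xy.1 xy.2 | xy in [set: quot (N i) * quot (N i)]].
Proof.
split.
  pose o := quot_pi (N i) 1%g.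
  by exists (cayley_dist S R o o), (o, o).
have /finite_seqP[s sE] := fN.
(* Finite index leaves finitely many quotients of representatives, and one ball contains them
   all. *)
have [n sn] := wball_exhaust_seq [seq ((repr x)^-1 * repr y)%g | x <- s, y <- s] gS.
exists n%:R => _ [[x y] _ <-] /=; apply/cayley_dist_le.
rewrite -[x]quot_pi_repr; apply/(qcloseP nN); exists ((repr x)^-1 * repr y)%g.
  have ms z : z \in s by have : [set: quot (N i)] z by []; rewrite sE.
  by apply/sn/allpairsP; exists (x, y).
by rewrite mulVKg quot_pi_repr.
Qed.

Lemma le_diameter (x y : quot (N i)) :
  cayley_dist S R x y <= diameter (@cayley_dist G S R N i).
Proof. by apply: sup_ubound; [case: has_sup_cayley_dist|exists (x, y)]. Qed.

Lemma diameter_ge0 : 0 <= diameter (@cayley_dist G S R N i).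
Proof.
exact: le_trans (cayley_dist_ge0 _ _) (le_diameter (quot_pi (N i) 1) (quot_pi (N i) 1)).
Qed.

End CayleyDist.

(** * Coarse equivalences between box spaces *)

Section Control.
Variable R : realType.

Lemma le_some_nat (x : R) : exists n : nat, x <= n%:R.
Proof. by exists (Num.truncn x).+1; rewrite ltW// real_truncnS_gt// num_real. Qed.

Lemma proper_bound (rho : R -> R) (n : nat) : proper_nneg rho ->
  exists m : nat, forall t, 0 <= t -> rho t <= n%:R -> t <= m%:R.
Proof.
case=> rho0 /(_ [set x : R | 0 <= x <= n%:R]) [].
  exists n%:R; split; first exact: num_real.
  by move=> x nx y /= /andP[y0 yn]; rewrite ger0_norm// (le_trans yn)// ltW.
(* [bounded_set] gives a norm bound by every number greater than [M]; [M + 1] is one of them. *)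
move=> M [_ /(_ (M + 1))]; rewrite ltrDl ltr01 => /(_ isT) bnd.
have [m Mm] := le_some_nat (M + 1); exists m => t t0 tn.
apply: le_trans Mm; rewrite -[t]ger0_norm//; apply: (bnd t).
by split=> //=; rewrite rho0.
Qed.

(** Properness bounds preimages, not images, and [rho] need not be monotone. Distances inside a
    component are naturals, however, so only finitely many values of [rho] matter below a given
    distance. *)
Lemma nat_values_bound (rho : R -> R) (n : nat) :
  exists m : nat, forall k, (k <= n)%N -> rho k%:R <= m%:R.
Proof.
elim: n => [|n [m IH]].
  by have [m ?] := le_some_nat (rho 0); exists m => k; rewrite leqn0 => /eqP->.
have [p rp] := le_some_nat (rho n.+1%:R); exists (maxn m p) => k.
rewrite leq_eqVlt => /predU1P[->|/IH km].
  by rewrite (le_trans rp)// ler_nat leq_maxr.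
by rewrite (le_trans km)// ler_nat leq_maxl.
Qed.

End Control.

Section Box.
Variables (R : realType) (G : groupType) (S : seq G) (M : nat -> groupClosed G).
Hypotheses (gS : generates S) (filM : filtration M) (infG : infinite_group G).

Local Notation point i x := (existT (fun k => quot (M k)) i x).

(** Take [g] outside the ball of radius [n]. Once [M i] contains no [b^-1 * g] with [b] in the ball,
    the coset of [g] is further than [n] from that of 1. *)
Lemma diameter_eventually (n : nat) : exists i0, forall i, (i0 <= i)%N ->
  n%:R < diameter (@cayley_dist G S R M i).
Proof.
have [g gn] := infG (wball S n).
have [i0 trM] := filtration_eventually [seq (b^-1 * g)%g | b <- wball S n] filM.
have [_ nM fM _] := filM.
exists i0 => i i0i.
apply: lt_le_trans
  (le_diameter R gS (nM i) (fM i) (quot_pi _ 1%g) (quot_pi _ g)).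
rewrite ltNge; apply/negP => /(cayley_dist_le R gS (nM i)).
move=> /(qcloseP (nM i))[b bn]; rewrite mul1g => /esym/quot_piP Mbg.
move: gn; suff -> : g = b by rewrite bn.
apply/esym/(mulgI b^-1%g); rewrite mulVg; apply/esym/(trM i i0i) => //; exact: map_f.
Qed.

Lemma box_dist_same i (x y : quot (M i)) :
  box_dist S R M (point i x) (point i y) = cayley_dist S R x y.
Proof. by rewrite /box_dist /= eqxx tagged_asE. Qed.

Lemma box_dist_diff (a b : box_space M) : tag a != tag b ->
  box_dist S R M a b = diameter (@cayley_dist G S R M (tag a)) +
                       diameter (@cayley_dist G S R M (tag b)).
Proof. by rewrite /box_dist => /negPf->. Qed.

Lemma box_dist_ge0 (a b : box_space M) : 0 <= box_dist S R M a b.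
Proof.
have [_ nM fM _] := filM.
have [tab|tab] := eqVneq (tag a) (tag b); last first.
  by rewrite box_dist_diff// addr_ge0 ?diameter_ge0.
case: a b tab => [i x] [j y] /= ij; subst j.
by rewrite box_dist_same cayley_dist_ge0.
Qed.

(** Distinct components are at least the diameter of either apart. As diameters grow, a bounded jump
    cannot leave a late component. *)
Lemma box_dist_eq_tag (a b : box_space M) :
  box_dist S R M a b < diameter (@cayley_dist G S R M (tag a)) -> tag a = tag b.
Proof.
have [_ nM fM _] := filM.
move=> ab; apply/eqP; apply: contraTT ab => /box_dist_diff->.
by rewrite -leNgt lerDl diameter_ge0.
Qed.

Lemma box_dist_qclose i (x y : quot (M i)) n :
  box_dist S R M (point i x) (point i y) <= n%:R <-> qclose (wball S n) x y.
Proof. by have [_ nM _ _] := filM; rewrite box_dist_same; exact: cayley_dist_le. Qed.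

(** Only finitely many points lie in the components before [i0]. *)
Lemma tag_bound (t : box_space M -> nat) (i0 : nat) :
  exists J, forall a : box_space M, (tag a < i0)%N -> (t a < J)%N.
Proof.
have [_ _ fM _] := filM.
elim: i0 => [|i0 [J IH]]; first by exists 0.
have /finite_seqP[s sE] := fM i0.
have [J' sJ'] : exists J', forall x, x \in s -> (t (point i0 x) < J')%N.
  elim: (s) => [|x l [J' lJ']]; first by exists 0.
  exists (maxn (t (point i0 x)).+1 J') => y /predU1P[->|/lJ']; rewrite leq_max ?leqnn//.
  by move=> ->; rewrite orbT.
exists (maxn J J') => -[i x] /=; rewrite ltnS leq_eqVlt.
case/predU1P=> [ii0|/(IH (point i x)) tJ].
  subst i; rewrite leq_max sJ' ?orbT//.
  by have : [set: quot (M i0)] x by []; rewrite sE.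
by rewrite leq_max tJ.
Qed.

End Box.

Lemma connected_invariant (G : groupType) (S : seq G) (N : groupClosed G)
    (T : Type) (W : quot N -> T) :
  generates S -> normal_subgroup N ->
  (forall x y, qclose S x y -> W y = W x) -> forall x y, W x = W y.
Proof.
move=> gS nN WS.
suff W1 x : W x = W (quot_pi N 1) by move=> x y; rewrite !W1.
elim/quot_piW: x => g.
apply: (generates_invariant (W := fun h => W (quot_pi N h)) gS) => h s sS.
by apply: WS; apply: qclose_pi.
Qed.

Lemma box_space_tagP (G : groupType) (M : nat -> groupClosed G) i
    (a : box_space M) :
  tag a = i -> exists x, a = existT (fun k => quot (M k)) i x.
Proof. by case: a => k x /= ik; subst k; exists x. Qed.

(* [B] is chosen after the constants of the quasi-inverse, and [F] after the
   control on [q]: cocycles on [G] are considered at the scale [B], which must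
   absorb [B2], and the girth of [N j] must exceed the resulting scale [D]. *)
Lemma coarse_components (R : realType) (G K : groupType) (S : seq G)
    (T : seq K) (M : nat -> groupClosed G) (N : nat -> groupClosed K) :
  generates S -> generates T -> filtration M -> filtration N ->
  infinite_group G -> infinite_group K ->
  coarsely_equivalent (box_dist S R M) (box_dist T R N) ->
  exists (B2 : seq G) (C : seq K), forall B : seq G, exists D : seq K,
  forall F : seq K, exists i j (q : quot (M i) -> quot (N j))
    (psi : quot (N j) -> quot (M i)),
  [/\ forall k, k \in F -> k \in N j -> k = 1%g,
      forall x x', qclose B x x' -> qclose D (q x) (q x'),
      forall y, qclose C (q (psi y)) y &
      forall y y', qclose T y y' -> qclose B2 (psi y) (psi y')].
Proof.
move=> gS gT filM filN infG infK [phi [[rm [rp [prm prp ctrl]]] [C C0 dense]]].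
have [_ nM _ _] := filM; have [_ nN fN _] := filN.
have [nC CnC] := le_some_nat C.
(* One edge plus the density constant at both of its ends: this bounds the distance between the
   [phi]-images of points chosen near two adjacent cosets. *)
have [R2 R2P] := proper_bound (nC + 1 + nC) prm.
have low a b : box_dist T R N (phi a) (phi b) <= (nC + 1 + nC)%:R ->
    box_dist S R M a b <= R2%:R.
  move=> ab; apply: R2P; first exact: box_dist_ge0.
  by have /andP[lab _] := ctrl a b; exact: le_trans ab.
exists (wball S R2), (wball T nC) => B.
have [r Br] := wball_exhaust_seq B gS.
(* Radius [r] covers the scale [B]; radius 1 covers the edges along which [phi] is shown to stay in
   one component. *)
have [P rpP] := nat_values_bound rp (maxn r 1).
have up i (x x' : quot (M i)) n : (n <= maxn r 1)%N -> qclose (wball S n) x x' ->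
    box_dist T R N (phi (existT _ i x)) (phi (existT _ i x')) <= P%:R.
  move=> nr xx'; have /andP[_] := ctrl (existT _ i x) (existT _ i x').
  rewrite box_dist_same; have [k -> kP] := cayley_dist_nat R gS (nM i) x x'.
  by move=> /le_trans; apply; apply: rpP; apply: leq_trans nr; apply/kP.
exists (wball T P) => F.
have [i0 diamX] := diameter_eventually R gS filM infG R2.
have [J phiJ] := tag_bound filM (fun a => tag (phi a)) i0.
have [j1 diamY] := diameter_eventually R gT filN infK (maxn nC P).
have [j2 trN] := filtration_eventually F filN.
(* From [J] on, component [j] receives no point from components before [i0]; from [j1] on its
   diameter exceeds the controlled distances; from [j2] on [N j] meets [F] at most in 1. *)
pose j := maxn J (maxn j1 j2).
have [Jj j1j j2j] : [/\ (J <= j)%N, (j1 <= j)%N & (j2 <= j)%N].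
  by rewrite /j !leq_max !leqnn !orbT.
have {}diamY n : (n <= maxn nC P)%N -> n%:R < diameter (@cayley_dist K T R N j).
  by move=> nP; apply: le_lt_trans (diamY j j1j); rewrite ler_nat.
have [psi0 psi0P] := choice (fun y : quot (N j) => dense (existT _ j y)).
have tag_phi y : tag (phi (psi0 y)) = j.
  apply/esym/(@box_dist_eq_tag R _ T N gT filN (existT _ j y)) => /=.
  by apply: le_lt_trans (diamY nC (leq_maxl _ _)); exact: le_trans (psi0P y) CnC.
have i0_psi y : (i0 <= tag (psi0 y))%N.
  by rewrite leqNgt; apply/negP => /phiJ; rewrite tag_phi ltnNge Jj.
have phi_psi y z : phi (psi0 y) = existT _ j z -> qclose (wball T nC) y z.
  move=> yz; apply/(box_dist_qclose R gT filN); rewrite -yz.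
  exact: le_trans (psi0P y) CnC.
have adj y y' : qclose T y y' -> box_dist S R M (psi0 y) (psi0 y') <= R2%:R.
  move=> yy'; apply: low.
  have [z zE] := box_space_tagP (tag_phi y).
  have [z' zE'] := box_space_tagP (tag_phi y').
  rewrite zE zE'; apply/(box_dist_qclose R gT filN).
  apply: (qclose_wball_trans (nN j)) (phi_psi _ _ zE').
  apply: (qclose_wball_trans (nN j)) (qclose_wball_sym (nN j) (phi_psi _ _ zE)) _.
  by apply: sub_qclose yy' => t /mem_letters/wball_letters.
(* Adjacent cosets are sent by [psi0] at most [R2] apart, less than the diameter of the component
   reached, so by connectedness the image of [psi0] lies in a single component. *)
pose i := tag (psi0 (quot_pi (N j) 1%g)).
have psi_i y : tag (psi0 y) = i.
  apply: (connected_invariant (W := fun y => tag (psi0 y)) gT (nN j)).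
  move=> {}y y' /adj yy'; apply/esym/(box_dist_eq_tag gS filM).
  by apply: le_lt_trans yy' _; exact: diamX.
have [psi psiE] := choice (fun y => box_space_tagP (psi_i y)).
have phi_step (x x' : quot (M i)) : qclose (wball S 1) x x' ->
    tag (phi (existT _ i x)) = j -> tag (phi (existT _ i x')) = j.
  move=> xx' xj; rewrite -[RHS]xj; apply/esym/(box_dist_eq_tag gT filN).
  rewrite xj; apply: le_lt_trans (diamY P (leq_maxr _ _)).
  exact: up (leq_maxr _ _) xx'.
(* Landing in component [j] is preserved along edges in both directions, and it holds at one point
   in the image of [psi]. *)
have phi_j (x : quot (M i)) : tag (phi (existT _ i x)) = j.
  apply/eqP; pose W x := tag (phi (existT (fun k => quot (M k)) i x)) == j.
  rewrite -/(W x) (_ : W x = W (psi (quot_pi (N j) 1%g))).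
    by rewrite /W -psiE tag_phi.
  apply: (connected_invariant gS (nM i)) => {}x x' xx'.
  have {xx'}xx' : qclose (wball S 1) x x'.
    by apply: sub_qclose xx' => t /mem_letters/wball_letters.
  apply/idP/idP => /eqP; rewrite /W => /phi_step -> //.
  exact: qclose_wball_sym.
have [q qE] := choice (fun x => box_space_tagP (phi_j x)).
exists i, j, q, psi; split.
- exact: trN.
- move=> x x' xx'; apply/(box_dist_qclose R gT filN); rewrite -!qE.
  apply: (up _ _ _ r); first exact: leq_maxl.
  exact: sub_qclose xx'.
- by move=> y; apply: (qclose_wball_sym (nN j)); apply: phi_psi; rewrite psiE qE.
- by move=> y y' /adj; rewrite !psiE => /(box_dist_qclose R gS filM).
Qed.

(** * Coarse 1-cocycles with values in Z/2 *)

Section CosetDiff.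
Variables (K : groupType) (N : groupClosed K) (D : seq K).

(* [U (n * k) = chi n (+) U k] for a homomorphism [chi : N -> Z/2]; its
   coboundary is then a function on pairs of nearby cosets of [N], and
   represents [chi] in the coarse cohomology of [K / N]. *)
Definition quasi_invariant (U : K -> bool) := forall n, n \in N ->
  forall k k', U (n * k)%g (+) U k = U (n * k')%g (+) U k'.

(** A chosen lift of a pair of [D]-close cosets; [(1, 1)] is the default for other pairs. *)
Definition lift_step (y y' : quot N) : K * K :=
  xget (1%g, 1%g) [set p | [/\ y = quot_pi N p.1, p.2 \in D &
                               y' = quot_pi N (p.1 * p.2)%g]].

Definition coset_diff (U : K -> bool) (y y' : quot N) : bool :=
  let p := lift_step y y' in U p.1 (+) U (p.1 * p.2)%g.

Lemma coset_diffD U U' y y' :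
  coset_diff (fun k => U k (+) U' k) y y' = coset_diff U y y' (+) coset_diff U' y y'.
Proof. by rewrite /coset_diff addbACA. Qed.

Hypotheses (nN : normal_subgroup N) (D1 : 1%g \in D).
Hypothesis girth : forall d1 d2 d3 d4,
  d1 \in D -> d2 \in D -> d3 \in D -> d4 \in D ->
  ((d1 * d2)^-1 * (d3 * d4))%g \in N -> (d1 * d2)%g = (d3 * d4)%g.

(** The chosen lift is immaterial: its base point differs by a left factor in [N], harmless by
    quasi-invariance, and [girth], with 1 as the second factors, forces the same step [d]. *)
Lemma coset_diffE U k d : quasi_invariant U -> d \in D ->
  coset_diff U (quot_pi N k) (quot_pi N (k * d)%g) = U k (+) U (k * d)%g.
Proof.
move=> qU Dd; rewrite /coset_diff /lift_step; case: xgetP => [p _ []|/(_ (k, d))/=[]//].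
move=> /(quot_pi_lift nN)[n Nn ->] Dp; rewrite -mulgA (quot_piMl nN _ Nn).
move=> /quot_pi_cancel Ndp; rewrite (_ : p.2 = d); last first.
  have := girth Dd D1 Dp D1; rewrite !mulg1 => -> //.
have := qU _ Nn k (k * d)%g.
by case: (U k); case: (U (k * d)%g); case: (U (n * k)%g); case: (U _).
Qed.

Variable U : K -> bool.
Hypothesis qU : quasi_invariant U.

(** By [girth] a triangle of close cosets lifts to a triangle in [K], where the differences of [U]
    telescope. *)
Lemma coset_diff_cocycle y1 y2 y3 :
  qclose D y1 y2 -> qclose D y2 y3 -> qclose D y1 y3 ->
  coset_diff U y1 y2 (+) coset_diff U y2 y3 = coset_diff U y1 y3.
Proof.
elim/quot_piW: y1 => k /(qcloseP nN)[d Dd ->] /(qcloseP nN)[d' Dd' ->].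
move=> /(qcloseP nN)[e De e'].
have dd' : (d * d')%g = e.
  rewrite -[e]mulg1; apply: girth => //; rewrite mulg1.
  by apply: (@quot_pi_cancel _ N k); rewrite mulgA.
rewrite !(coset_diffE _ qU)// e' coset_diffE// -mulgA dd'.
by case: (U k); case: (U _); case: (U _).
Qed.

(** As [p] is close to the identity, a primitive of the pullback along [p] yields a primitive [v] of
    the cocycle itself. Then [U] and [v] differ by a constant, and [v] is defined on cosets of
    [N]. *)
Lemma coset_diff_coboundary (T C : seq K) (p : quot N -> quot N)
    (u : quot N -> bool) :
  generates T -> {subset T <= D} -> {subset C <= D} ->
  (forall y, qclose C (p y) y) ->
  (forall y y', qclose T y y' -> qclose D (p y) (p y') /\
     coset_diff U (p y) (p y') = u y (+) u y') ->
  forall n k, n \in N -> U (n * k)%g = U k.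
Proof.
move=> gT TD CD pC puE n k Nn.
(* Two sides of the square form a product of two elements of [D], as do the other two; [girth] makes
   the products equal, so the square lifts to [K]. *)
have square z z' y y' : qclose C z y -> qclose D z z' -> qclose C z' y' ->
    qclose T y y' -> coset_diff U z y (+) coset_diff U y y' =
                     coset_diff U z z' (+) coset_diff U z' y'.
  elim/quot_piW: z => g /(qcloseP nN)[c Cc ->] /(qcloseP nN)[d Dd ->].
  move=> /(qcloseP nN)[c' Cc' ->] /(qcloseP nN)[t Tt yE].
  have ctdc : (c * t)%g = (d * c')%g.
    apply: girth => //; [exact: CD | exact: TD | exact: CD |].
    by apply: (@quot_pi_cancel _ N g); rewrite !mulgA -yE.
  have := coset_diffE g qU Dd; have := coset_diffE (g * d)%g qU (CD _ Cc').
  rewrite yE; have := coset_diffE g qU (CD _ Cc).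
  have := coset_diffE (g * c)%g qU (TD _ Tt) => -> -> + ->.
  rewrite -yE => ->; rewrite -!mulgA ctdc.
  by case: (U g); case: (U (g * c)%g); case: (U (g * d)%g); case: (U (g * _)%g).
(* The correction term is the value of the cocycle on the short step from [p y] to [y]. *)
pose v y := u y (+) coset_diff U (p y) y.
pose W h := U h (+) v (quot_pi N h).
suff WT : forall h t, t \in T -> W (h * t)%g = W h.
  have := generates_invariant gT WT; move=> WC.
  have : W (n * k)%g = W k by rewrite (WC (n * k)%g) (WC k).
  by rewrite /W quot_piMl// => /addIb.
move=> h t tT; pose y := quot_pi N h; pose y' := quot_pi N (h * t)%g.
have yy' : qclose T y y' by exact: qclose_pi.
have [pp' pE] := puE _ _ yy'.
have dyy' : coset_diff U y y' = U h (+) U (h * t)%g by rewrite coset_diffE ?TD.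
have := square _ _ _ _ (pC y) pp' (pC y') yy'.
rewrite pE dyy' /W /v -/y -/y'.
by case: (U h); case: (U (h * t)%g); case: (u y); case: (u y');
  case: (coset_diff _ _ _); case: (coset_diff _ _ _).
Qed.

End CosetDiff.

(** * The Heisenberg group *)

Lemma int_shift_ind (P : int -> Prop) :
  P 0 -> (forall k, P k <-> P (k + 1)) -> forall k, P k.
Proof.
move=> P0 Psh; elim/int_ind => [//|n IH|n IH].
- have -> : n.+1%:Z = n%:Z + 1 by lia.
  exact: (Psh n%:Z).1.
- by apply/Psh; have -> : - n.+1%:Z + 1 = - n%:Z by lia.
Qed.

Lemma int_primitive (e : int -> bool) :
  exists I : int -> bool, forall k, I (k + 1) (+) I k = e k.
Proof.
pose fix up n := if n is m.+1 then up m (+) e m%:Z else false.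
pose fix down n := if n is m.+1 then down m (+) e (- m.+1%:Z) else false.
(* [Negz n] is [- (n + 1)], reached after [n.+1] downward steps. *)
exists (fun k => match k with Posz n => up n | Negz n => down n.+1 end).
case=> [n|[|n]].
- by rewrite -PoszD addn1 /= addbAC addbb.
- by rewrite (_ : Negz 0 + 1 = 0)//=.
- rewrite (_ : Negz n.+1 + 1 = Negz n); last by lia.
  by rewrite /= NegzE; case: (down n); case: (e (- _)) => //=; case: (e _).
Qed.

(* Matrix product of unitriangular 3x3 integer matrices, with (a, b, c)
   standing for the entries (1,2), (2,3) and (1,3). *)
Definition heis : Type := (int * int * int)%type.
HB.instance Definition _ := Choice.on heis.

Definition heis_pt (a b c : int) : heis := (a, b, c).
Definition heis_mul (g h : heis) : heis :=
  heis_pt (g.1.1 + h.1.1) (g.1.2 + h.1.2) (g.2 + h.2 + g.1.1 * h.1.2).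
Definition heis_inv (g : heis) : heis :=
  heis_pt (- g.1.1) (- g.1.2) (g.1.1 * g.1.2 - g.2).

Lemma heis_eq (g h : heis) :
  g.1.1 = h.1.1 -> g.1.2 = h.1.2 -> g.2 = h.2 -> g = h.
Proof. by case: g => [[? ?] ?]; case: h => [[? ?] ?] /= -> -> ->. Qed.

Fact heis_mulA : associative heis_mul.
Proof. by move=> g h k; apply: heis_eq => /=; ring. Qed.
Fact heis_mul1 : left_id (heis_pt 0 0 0) heis_mul.
Proof. by move=> g; apply: heis_eq => /=; ring. Qed.
Fact heis_mulr1 : right_id (heis_pt 0 0 0) heis_mul.
Proof. by move=> g; apply: heis_eq => /=; ring. Qed.
Fact heis_mulV : left_inverse (heis_pt 0 0 0) heis_inv heis_mul.
Proof. by move=> g; apply: heis_eq => /=; ring. Qed.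
Fact heis_mulrV : right_inverse (heis_pt 0 0 0) heis_inv heis_mul.
Proof. by move=> g; apply: heis_eq => /=; ring. Qed.

HB.instance Definition _ := isGroup.Build heis heis_mulA heis_mul1 heis_mulr1
  heis_mulV heis_mulrV.

Lemma heis_ptE g : g = heis_pt g.1.1 g.1.2 g.2.
Proof. by case: g => [[]]. Qed.

Lemma heis_ptM a b c a' b' c' : (heis_pt a b c * heis_pt a' b' c')%g =
  heis_pt (a + a') (b + b') (c + c' + a * b').
Proof. by []. Qed.

Lemma heis_ptV a b c : (heis_pt a b c)^-1%g = heis_pt (- a) (- b) (a * b - c).
Proof. by []. Qed.

Definition heis_gens : seq heis :=
  [:: heis_pt 1 0 0; heis_pt 0 1 0; heis_pt 0 0 1].

Lemma heis_generated : generates heis_gens.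
Proof.
move=> K gK.
have pow (p : int -> heis) : p 0 = 1%g ->
    (forall k, p (k + 1) = (p k * p 1%R)%g) -> p 1 \in K -> forall k, p k \in K.
  move=> p0 pS p1; apply: int_shift_ind => [|k]; first by rewrite p0 gpred1.
  by rewrite pS gpredMr.
move=> g.
(* In the order z, y, x the product has no cross term, so the exponents are the coordinates. *)
have -> : g = (heis_pt 0 0 g.2 * heis_pt 0 g.1.2 0 * heis_pt g.1.1 0 0)%g.
  by apply: heis_eq => /=; ring.
have xP k : heis_pt k 0 0 \in K.
  apply: (pow (fun k => heis_pt k 0 0)) => [//|{}k|].
    by apply: heis_eq => //=; ring.
  by apply: gK; rewrite !inE eqxx.
have yP k : heis_pt 0 k 0 \in K.
  apply: (pow (fun k => heis_pt 0 k 0)) => [//|{}k|].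
    by apply: heis_eq => //=; ring.
  by apply: gK; rewrite !inE eqxx orbT.
have zP k : heis_pt 0 0 k \in K.
  apply: (pow (fun k => heis_pt 0 0 k)) => [//|{}k|].
    by apply: heis_eq => //=; ring.
  by apply: gK; rewrite !inE eqxx !orbT.
exact: gpredM (gpredM _ _ (zP _) (yP _)) (xP _).
Qed.

(* The three hypotheses say that [(ex, ey, ez)] sums to zero around the
   relators of the presentation <x, y, z | xz = zx, yz = zy, xy = yxz>. *)
Lemma heis_integrate (ex ey ez : heis -> bool) :
  let x := heis_pt 1 0 0 in let y := heis_pt 0 1 0 in let z := heis_pt 0 0 1 in
  (forall g, ex g (+) ez (g * x)%g = ez g (+) ex (g * z)%g) ->
  (forall g, ey g (+) ez (g * y)%g = ez g (+) ey (g * z)%g) ->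
  (forall g, ex g (+) ey (g * x)%g = ey g (+) ex (g * y)%g (+) ez (g * y * x)%g) ->
  exists V : heis -> bool, forall g,
    [/\ V (g * x)%g (+) V g = ex g, V (g * y)%g (+) V g = ey g &
        V (g * z)%g (+) V g = ez g].
Proof.
move=> x y z xz yz xy.
have [Iz IzE] := int_primitive (fun c => ez (heis_pt 0 0 c)).
have [Iy IyE] := choice (fun c => int_primitive (fun b => ey (heis_pt 0 b c))).
have [Ix IxE] := choice (fun bc : int * int =>
  int_primitive (fun a => ex (heis_pt a bc.1 bc.2))).
(* [V] integrates along the path from 1 that follows z, then y, then x. The x-edges hold by
   construction. The z-edges spread from the z-axis by [yz] and then [xz], the y-edges from the
   plane [a = 0] by [xy]. *)
pose V0 b c := Iz c (+) Iy c b (+) Iy c 0.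
pose V (g : heis) := V0 g.1.2 g.2 (+) Ix (g.1.2, g.2) g.1.1 (+) Ix (g.1.2, g.2) 0.
have mulx a b c : (heis_pt a b c * x)%g = heis_pt (a + 1) b c.
  by apply: heis_eq => /=; ring.
have muly a b c : (heis_pt a b c * y)%g = heis_pt a (b + 1) (c + a).
  by apply: heis_eq => /=; ring.
have mulz a b c : (heis_pt a b c * z)%g = heis_pt a b (c + 1).
  by apply: heis_eq => /=; ring.
have Vx g : V (g * x)%g (+) V g = ex g.
  rewrite (heis_ptE g) mulx /V /= -(IxE (g.1.2, g.2)).
  by case: (V0 _ _); do 3 case: (Ix _ _).
have V0x b c : V (heis_pt 0 b c) = V0 b c by rewrite /V/= -addbA addbb addbF.
have Vy0 b c : V (heis_pt 0 (b + 1) c) (+) V (heis_pt 0 b c) = ey (heis_pt 0 b c).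
  rewrite !V0x /V0 -IyE.
  by case: (Iz _); do 3 case: (Iy _ _).
have Vz0 b c : V (heis_pt 0 b (c + 1)) (+) V (heis_pt 0 b c) = ez (heis_pt 0 b c).
  move: b; apply: int_shift_ind => [|b].
    by rewrite !V0x /V0 -IzE; do 2 case: (Iz _); do 2 case: (Iy _ _).
  have := yz (heis_pt 0 b c); rewrite muly mulz addr0 -Vy0 -Vy0.
  by do 4 case: (V _); do 2 case: (ez _).
have Vz a b c : V (heis_pt a b (c + 1)) (+) V (heis_pt a b c) = ez (heis_pt a b c).
  move: a; apply: int_shift_ind => [//|a].
  have := xz (heis_pt a b c); rewrite mulx mulz -Vx -Vx !mulx.
  by do 4 case: (V _); do 2 case: (ez _).
have Vy a b c : V (heis_pt a (b + 1) (c + a)) (+) V (heis_pt a b c) =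
    ey (heis_pt a b c).
  move: a c; apply: (int_shift_ind (P := fun a => forall c, _)) => [c|a].
    by rewrite addr0.
  have key c : (V (heis_pt a (b + 1) (c + a)) (+) V (heis_pt a b c) =
    ey (heis_pt a b c)) <-> (V (heis_pt (a + 1) (b + 1) (c + (a + 1))) (+)
      V (heis_pt (a + 1) b c) = ey (heis_pt (a + 1) b c)).
    have := xy (heis_pt a b c); rewrite !(mulx, muly) -Vx -Vx -Vz !mulx addrA.
    by do 5 case: (V _); do 2 case: (ey _).
  by split=> H c; apply/key.
exists V => g; rewrite (heis_ptE g) Vx muly mulz.
by split.
Qed.

(** From scale 3 on, the relators split into triangles to which the cocycle identity applies, so the
    values on generator edges integrate; 3 is the length of the word yxz. The other values follow by
    induction on word length. *)
Lemma heis_coboundary n (f : heis -> heis -> bool) : (3 <= n)%N ->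
  (forall g b c, b \in wball heis_gens n -> c \in wball heis_gens n ->
     (b * c)%g \in wball heis_gens n ->
     f g (g * b)%g (+) f (g * b)%g (g * b * c)%g = f g (g * b * c)%g) ->
  exists V : heis -> bool, forall g b, b \in wball heis_gens n ->
    f g (g * b)%g = V g (+) V (g * b)%g.
Proof.
move=> n3 coc.
have f1 g : f g g = false.
  have := coc g 1%g 1%g; rewrite !mulg1 wball1 => /(_ isT isT isT).
  by case: (f g g).
have wb k b : (k <= 3)%N -> b \in wball heis_gens k -> b \in wball heis_gens n.
  by move=> k3; apply: sub_wball; exact: leq_trans n3.
have gens1 s : s \in heis_gens -> s \in wball heis_gens 1.
  by move=> /mem_letters/wball_letters.
have gens2 s t : s \in heis_gens -> t \in heis_gens ->
    (s * t)%g \in wball heis_gens 2.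
  by move=> /gens1 ? /gens1; exact: (@wballM _ _ 1 1).
have gens3 s t r : s \in heis_gens -> t \in heis_gens -> r \in heis_gens ->
    (s * t * r)%g \in wball heis_gens 3.
  by move=> hs ht /gens1; exact: (@wballM _ _ 2 1 _ _ (gens2 _ _ hs ht)).
pose x := heis_pt 1 0 0; pose y := heis_pt 0 1 0; pose z := heis_pt 0 0 1.
have [xg yg zg] : [/\ x \in heis_gens, y \in heis_gens & z \in heis_gens].
  by rewrite !inE !eqxx !orbT.
have coc2 g s t : s \in heis_gens -> t \in heis_gens ->
    f g (g * s)%g (+) f (g * s)%g (g * s * t)%g = f g (g * (s * t))%g.
  move=> hs ht; rewrite mulgA.
  by apply: coc; [apply: (wb 1) | apply: (wb 1) | apply: (wb 2)] => //; auto.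
have [|||V VE] := @heis_integrate (fun g => f g (g * x)%g)
  (fun g => f g (g * y)%g) (fun g => f g (g * z)%g).
- by move=> g; rewrite !coc2.
- by move=> g; rewrite !coc2.
- move=> g; rewrite !coc2//.
  have <- : (y * x * z = x * y)%g by apply: heis_eq.
  rewrite [(g * (y * x * z))%g]mulgA -(mulgA g y x); symmetry; apply: coc.
  + exact: (wb 2).
  + exact: (wb 1).
  + exact: (wb 3).
exists V.
have step g s : s \in heis_gens -> f g (g * s)%g = V g (+) V (g * s)%g.
  have [vx vy vz] := VE g; rewrite addbC !inE.
  by case/or3P => /eqP->.
have lstep g s : s \in letters heis_gens -> f g (g * s)%g = V g (+) V (g * s)%g.
  rewrite inE mem_cat => /predU1P[->|/orP[|/mapP[t tS ->]]].
  - by rewrite mulg1 f1 addbb.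
  - exact: step.
  have := coc g t^-1%g t; rewrite mulgVK mulVg f1 wball1.
  have -> : t \in wball heis_gens n by apply: (wb 1); auto.
  have -> : t^-1%g \in wball heis_gens n by apply: (wb 1) => //; apply: wballV; auto.
  have := step (g * t^-1)%g t tS; rewrite mulgVK => -> /(_ isT isT isT).
  by case: (f _ _); case: (V _); case: (V _).
suff main m g b : (m <= n)%N -> b \in wball heis_gens m ->
    f g (g * b)%g = V g (+) V (g * b)%g by move=> g b; exact: main.
elim: m b => [b _|m IH b mn]; first by rewrite inE => /eqP->; rewrite mulg1 f1 addbb.
case/wballSP=> [c [s [cm sl bE]]].
have := coc g c s; rewrite -mulgA -bE IH ?(ltnW mn)//.
have -> : f (g * c)%g (g * b)%g = V (g * c)%g (+) V (g * b)%g.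
  by rewrite bE mulgA lstep.
have -> : c \in wball heis_gens n by apply: sub_wball cm; exact: ltnW.
have -> : s \in wball heis_gens n by apply: (wb 1) => //; exact: wball_letters.
have -> : b \in wball heis_gens n.
  by apply: (sub_wball mn); apply/wballSP; exists c, s.
move=> /(_ isT isT isT) <-.
by case: (V g); case: (V _); case: (V _).
Qed.

(** * Congruence subgroups *)

Lemma finite_index_reps (G : groupType) (N : groupClosed G) (s : seq G) :
  (forall g, exists2 h, h \in s & quot_pi N g = quot_pi N h) -> finite_index N.
Proof.
move=> sP; apply: (sub_finite_set _ (finite_seq (map (quot_pi N) s))).
elim/quot_piW => g _ /=; have [h hs ->] := sP g; exact: map_f.
Qed.

Lemma cap_filtrationP (G : groupType) (M : nat -> groupClosed G)
    (H : groupClosed G) : filtration M -> filtration (cap_filtration M H).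
Proof.
case=> decM nM fM trM; split=> [i h|i h g|i|g Ng].
- exact: decM.
- by rewrite !cap_subgroupE => /(nM i _ (val g)); rewrite /conjg !valM gmulfV.
- have /finite_seqP[s sE] := fM i.
  (* A coset that misses [H] gets the default 1; only cosets of elements of [H] are looked up. *)
  pose f x : subgroup H := xget 1%g [set h | quot_pi (M i) (val h) = x].
  apply: (@finite_index_reps _ _ (map f s)) => g; exists (f (quot_pi (M i) (val g))).
    apply: map_f; have : [set: quot (M i)] (quot_pi (M i) (val g)) by [].
    by rewrite sE.
  apply/quot_piP; rewrite cap_subgroupE valM gmulfV; apply/quot_piP.
  by rewrite /f; case: xgetP => [h _ /esym//|/(_ g)/(_ erefl)].
- by apply: val_inj; rewrite val1; apply: trM => i; exact: Ng.
Qed.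

Lemma infinite_groupP (G : groupType) (f : nat -> G) :
  injective f -> infinite_group G.
Proof.
move=> injf F; apply/not_existsP => FG.
suff : ((size F).+1 <= size F)%N by rewrite ltnn.
rewrite -[X in (X <= _)%N](size_iota 0) -(size_map f); apply: uniq_leq_size.
  by rewrite map_inj_uniq ?iota_uniq.
by move=> g _; apply/negPn/negP/FG.
Qed.

Lemma filtration_residually_finite (G : groupType) (M : nat -> groupClosed G) :
  filtration M -> residually_finite G.
Proof.
case=> _ nM fM trM g g1; have [i gM] : exists i, g \notin M i.
  apply: contra_notP g1 => nex; apply: trM => i.
  by apply: contra_notT nex => ?; exists i.
by exists (M i).
Qed.

Definition heis_cong (q : nat) : {pred heis} := fun g =>
  [&& (q %| g.1.1)%Z, (q %| g.1.2)%Z & (q %| g.2)%Z].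

Lemma heis_congP q g : reflect
  (exists a b c, g = heis_pt (a * q%:Z) (b * q%:Z) (c * q%:Z)) (g \in heis_cong q).
Proof.
apply: (iffP and3P) => [[/dvdzP[a ga] /dvdzP[b gb] /dvdzP[c gc]]|[a [b [c ->]]]].
  by exists a, b, c; apply: heis_eq.
by rewrite !dvdz_mull.
Qed.

Section HeisCongSubgroup.
Variable q : nat.

Fact heis_cong1 : 1%g \in heis_cong q.
Proof. by apply/and3P; rewrite !dvdz0. Qed.

Fact heis_congM : mulg_closed (heis_cong q).
Proof.
move=> g h /and3P[ga gb gc] /and3P[ha hb hc]; apply/and3P.
by split; rewrite ?rpredD// dvdz_mulr.
Qed.

Fact heis_congV : invg_closed (heis_cong q).
Proof.
move=> g /and3P[ga gb gc]; apply/and3P.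
by split; rewrite ?rpredB ?rpredN// dvdz_mulr.
Qed.

HB.instance Definition _ := isMulClosed.Build _ (heis_cong q) heis_congM.
HB.instance Definition _ := isMul1Closed.Build _ (heis_cong q) heis_cong1.
HB.instance Definition _ := isInvClosed.Build _ (heis_cong q) heis_congV.
End HeisCongSubgroup.

Definition heis_even : {pred heis} := fun g => (2 %| g.1.1)%Z.

Fact heis_even1 : 1%g \in heis_even. Proof. exact: dvdz0. Qed.
Fact heis_evenM : mulg_closed heis_even.
Proof. by move=> g h; exact: rpredD. Qed.
Fact heis_evenV : invg_closed heis_even.
Proof.
by move=> g ge; have : (2 %| - g.1.1)%Z by rewrite rpredN.
Qed.

HB.instance Definition _ := isMulClosed.Build _ heis_even heis_evenM.
HB.instance Definition _ := isMul1Closed.Build _ heis_even heis_even1.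
HB.instance Definition _ := isInvClosed.Build _ heis_even heis_evenV.

Definition heis_filtration (i : nat) : groupClosed heis := heis_cong (3 ^ i).

Lemma heis_filtrationP : filtration heis_filtration.
Proof.
split=> [i g|i g h|i|g gM].
- have d3 : ((3 ^ i)%N%:Z %| (3 ^ i.+1)%N%:Z)%Z by rewrite dvdzE /= expnS dvdn_mull.
  by move=> /and3P[ga gb gc]; apply/and3P; split; exact: dvdz_trans d3 _.
- move=> /heis_congP[a [b [c ->]]]; apply/heis_congP.
  exists a, b, (c + a * h.1.2 - h.1.1 * b).
  by rewrite (heis_ptE h) /conjg heis_ptV !heis_ptM; apply: heis_eq => /=; ring.
- pose q := (3 ^ i)%N; pose r := map Posz (iota 0 q).
  have q0 : q%:Z != 0 by rewrite /q; lia.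
  have modr k : (k %% q)%Z \in r.
    have := ltz_pmod k (_ : 0 < q%:Z); have := modz_ge0 k q0.
    case: (k %% q)%Z => // n _ nq; apply: map_f; rewrite mem_iota add0n /=.
    by apply: nq; rewrite lt_neqAle eq_sym q0.
  apply: (@finite_index_reps _ _ [seq heis_pt ab.1 ab.2 c |
    ab <- [seq (a, b) | a <- r, b <- r], c <- r]) => g.
  pose a := (g.1.1 %% q)%Z; pose b := (g.1.2 %% q)%Z.
  (* The last entry of [g^-1 * heis_pt a b c] is [c - (g.2 + g.1.1 * b - g.1.1 * g.1.2)]. *)
  pose c := ((g.2 + g.1.1 * b - g.1.1 * g.1.2) %% q)%Z.
  exists (heis_pt a b c).
    apply/allpairsP; exists ((a, b), c); split=> //; last exact: modr.
    by apply/allpairsP; exists (a, b); split=> //; exact: modr.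
  apply/quot_piP; rewrite (heis_ptE g) heis_ptV heis_ptM.
  have divr k : exists d, (k %% q)%Z = k - d * q%:Z.
    by exists (k %/ q)%Z; rewrite /modz.
  have [da aE] := divr g.1.1; have [db bE] := divr g.1.2.
  have [dc cE] := divr (g.2 + g.1.1 * b - g.1.1 * g.1.2).
  apply/heis_congP; exists (- da), (- db), (- dc); rewrite -/q.
  by apply: heis_eq => /=; rewrite /a /b /c ?aE ?bE ?cE /b ?bE; ring.
- have z0 (k : int) : (forall i, ((3 ^ i)%N%:Z %| k)%Z) -> k = 0.
    (* The modulus with exponent [|k|] already exceeds [|k|]. *)
    move=> /(_ `|k|%N); rewrite dvdzE => kd; apply/eqP.
    rewrite -absz_eq0 -leqn0 leqNgt; apply/negP => /dvdn_leq /(_ kd).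
    by rewrite leqNgt absz_nat (ltn_expl `|k|%N (isT : 1 < 3)%N).
  by apply: heis_eq; apply: z0 => i; have /and3P[] := gM i.
Qed.

Lemma heis_even_normal : normal_subgroup heis_even.
Proof.
move=> x g; rewrite /heis_even !unfold_in => xe.
by rewrite (_ : _.1.1 = x.1.1)// (heis_ptE g) /=; ring.
Qed.

Lemma heis_even_finite_index : finite_index heis_even.
Proof.
apply: (@finite_index_reps _ _ [:: heis_pt 0 0 0; heis_pt 1 0 0]) => g.
exists (heis_pt (g.1.1 %% 2)%Z 0 0).
  have := modz_ge0 g.1.1 (isT : 2 != 0 :> int).
  by have := ltz_pmod g.1.1 (isT : 0 < 2 :> int); case: (_ %% _)%Z => // -[|[|]].
apply/quot_piP; have : (2 %| - g.1.1 + (g.1.1 %% 2)%Z)%Z; last by [].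
by rewrite /modz addKr rpredN dvdz_mull.
Qed.

(** * Homomorphisms from congruence subgroups to Z/2 *)

Definition parity (k : int) : bool := odd `|k|%N.

Lemma parityD : {morph parity : j k / j + k >-> j (+) k}.
Proof. by move=> j k; rewrite /parity; lia. Qed.

Lemma parityM j k : parity (j * k) = parity j && parity k.
Proof. by rewrite /parity abszM oddM. Qed.

Lemma int_additive_parity (w : int -> bool) :
  {morph w : j k / j + k >-> j (+) k} -> forall k, w k = parity k && w 1.
Proof.
move=> wD; have w0 : w 0 = false by have := wD 0 0; rewrite addr0; case: (w 0).
apply: int_shift_ind => [|k]; first by rewrite w0.
by rewrite wD parityD; case: (w k); case: (w 1); case: (parity k).
Qed.

(* As [q] is odd and [z^(q^2)] is the commutator of [x^q] and [y^q], such a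
   homomorphism also kills [z^q]. *)
Lemma heis_cong_character (q : nat) (chi : heis -> bool) : odd q ->
  (forall g h, g \in heis_cong q -> h \in heis_cong q ->
     chi (g * h)%g = chi g (+) chi h) ->
  chi (heis_pt q 0 0) = false -> chi (heis_pt 0 q 0) = false ->
  forall g, g \in heis_cong q -> chi g = false.
Proof.
move=> oq chiM chix chiy.
have mem a b c : heis_pt (a * q%:Z) (b * q%:Z) (c * q%:Z) \in heis_cong q.
  by apply/heis_congP; exists a, b, c.
have memx a : heis_pt (a * q%:Z) 0 0 \in heis_cong q by have := mem a 0 0; rewrite !mul0r.
have memy b : heis_pt 0 (b * q%:Z) 0 \in heis_cong q by have := mem 0 b 0; rewrite !mul0r.
have memz c : heis_pt 0 0 (c * q%:Z) \in heis_cong q by have := mem 0 0 c; rewrite !mul0r.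
have xE a : chi (heis_pt (a * q%:Z) 0 0) = false.
  rewrite (int_additive_parity (w := fun a => chi (heis_pt (a * q%:Z) 0 0))).
    by rewrite mul1r chix andbF.
  move=> j k; rewrite -chiM//; congr chi.
  by apply: heis_eq => /=; ring.
have yE a : chi (heis_pt 0 (a * q%:Z) 0) = false.
  rewrite (int_additive_parity (w := fun a => chi (heis_pt 0 (a * q%:Z) 0))).
    by rewrite mul1r chiy andbF.
  move=> j k; rewrite -chiM//; congr chi.
  by apply: heis_eq => /=; ring.
have zE c : chi (heis_pt 0 0 (c * q%:Z)) = parity c && chi (heis_pt 0 0 q).
  rewrite (int_additive_parity (w := fun a => chi (heis_pt 0 0 (a * q%:Z)))).
    by rewrite mul1r.
  move=> j k; rewrite -chiM//; congr chi.
  by apply: heis_eq => /=; ring.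
have zq : chi (heis_pt 0 0 q) = false.
  have := zE q%:Z; rewrite {1}/parity absz_nat oq andTb => <-.
  have := chiM _ _ (memx 1) (memy 1); rewrite xE yE.
  rewrite (_ : (_ * _)%g =
    (heis_pt 0 0 (q%:Z * q%:Z) * (heis_pt 0 (1 * q%:Z) 0 * heis_pt (1 * q%:Z) 0 0))%g).
    by rewrite !chiM ?gpredM// xE yE !addbF.
  by apply: heis_eq => /=; ring.
move=> g /heis_congP[a [b [c ->]]].
have -> : heis_pt (a * q%:Z) (b * q%:Z) (c * q%:Z) =
    (heis_pt 0 0 (c * q%:Z) * (heis_pt 0 (b * q%:Z) 0 * heis_pt (a * q%:Z) 0 0))%g.
  by apply: heis_eq => /=; ring.
by rewrite !chiM ?gpredM// xE yE zE zq andbF.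
Qed.

(* On the even elements of [heis_cong q], with [q] odd, these are the eight
   homomorphisms to Z/2. *)
Definition heis_parities (q : nat) (e : bool * bool * bool) (g : heis) : bool :=
  (e.1.1 && parity (g.1.1 %/ (2 * q%:Z))%Z) (+)
  (e.1.2 && parity (g.1.2 %/ q%:Z)%Z) (+) (e.2 && parity (g.2 %/ q%:Z)%Z).

(** The cross term adds [2 * (a * g.1.2)] to the third quotient and is invisible modulo 2; here the
    evenness of the first entry is decisive. As [g] is arbitrary, this also gives
    quasi-invariance. *)
Lemma heis_paritiesM q e a b c g : (0 < q)%N ->
  heis_parities q e (heis_pt (a * (2 * q%:Z)) (b * q%:Z) (c * q%:Z) * g)%g =
  [&& e.1.1 & parity a] (+) [&& e.1.2 & parity b] (+) [&& e.2 & parity c] (+)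
  heis_parities q e g.
Proof.
move=> q0; rewrite (heis_ptE g) heis_ptM /heis_parities /=.
have q1 : q%:Z != 0 by lia.
have q2 : 2 * q%:Z != 0 by lia.
rewrite !divzMDl//.
rewrite (_ : c * _ + _ + _ = (c + 2 * (a * g.1.2)) * q%:Z + g.2); last by ring.
rewrite divzMDl// !parityD parityM /= addbF.
by case: e => [[[] []] []] /=; do 3 case: (parity _) => /=; do 3 case: (parity _).
Qed.

Lemma heis_cong_even q n : odd q -> n \in heis_cong q -> n \in heis_even ->
  exists a b c, n = heis_pt (a * (2 * q%:Z)) (b * q%:Z) (c * q%:Z).
Proof.
move=> oq /heis_congP[a [b [c ->]]]; rewrite unfold_in /heis_even /= => aq.
have /dvdzP[d ->] : (2 %| a)%Z.
  by move: aq; rewrite Gauss_dvdzl// /coprimez /gcdz /= eqz_nat -/(coprime 2 q) coprime2n.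
by exists d, b, c; apply: heis_eq => //=; ring.
Qed.

Lemma heis_infinite : infinite_group heis.
Proof. by apply: (@infinite_groupP _ (fun k : nat => heis_pt 0 0 k)) => j k []. Qed.

Lemma heis_even_infinite : infinite_group (subgroup heis_even).
Proof.
have zE (k : nat) : heis_pt 0 0 k \in heis_even by exact: dvdz0.
pose f k : subgroup heis_even := exist (fun g => g \in heis_even) _ (zE k).
have injf : injective f by move=> j k /(congr1 val)[].
exact: infinite_groupP injf.
Qed.

Lemma odd3X i : odd (3 ^ i). Proof. by rewrite oddX orbT. Qed.

Lemma heis_parities_quasi_invariant j e :
  quasi_invariant (cap_filtration heis_filtration heis_even j)
    (fun h => heis_parities (3 ^ j) e (val h)).
Proof.
move=> n Nn k k'; rewrite !valM.
have [a [b [c ->]]] := heis_cong_even (odd3X j) Nn (valP n).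
by rewrite !heis_paritiesM ?expn_gt0// -[LHS]addbA -[RHS]addbA !addbb.
Qed.

(** Evaluation at x^(2q), y^q and z^q recovers the three bits of [e]. *)
Lemma heis_parities_inj q e : (0 < q)%N ->
  (forall g, g \in heis_cong q -> g \in heis_even -> heis_parities q e g = false) ->
  e = (false, false, false).
Proof.
move=> q0 eP.
have H a b c : [&& e.1.1 & parity a] (+) [&& e.1.2 & parity b] (+)
    [&& e.2 & parity c] = false.
  have := eP (heis_pt (a * (2 * q%:Z)) (b * q%:Z) (c * q%:Z) * 1)%g.
  rewrite heis_paritiesM// => <-.
  - by rewrite /heis_parities !div0z !andbF !addbF.
  - by rewrite mulg1; apply/and3P; rewrite !dvdz_mull.
  - by rewrite mulg1; apply: dvdz_mull; exact: dvdz_mulr.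
have := H 1 0 0; have := H 0 1 0; have := H 0 0 1.
by case: {+}e => [[[] []] []].
Qed.

(** * Comparison of the two box spaces *)

Lemma heis_box_not_coarsely_equivalent (R : realType) (S : seq heis)
    (T : seq (subgroup heis_even)) : generates S -> generates T ->
  ~ coarsely_equivalent (box_dist S R heis_filtration)
      (box_dist T R (cap_filtration heis_filtration heis_even)).
Proof.
move=> gS gT eqv.
have filN := cap_filtrationP heis_even heis_filtrationP.
have [B2 [C cc]] := coarse_components gS gT heis_filtrationP filN heis_infinite
  heis_even_infinite eqv.
have [n0 B2n0] := wball_exhaust_seq B2 heis_generated.
(* Radius [n0] absorbs the scale of [psi]; 3 is what [heis_coboundary] requires. *)
pose n := maxn n0 3; pose B := wball heis_gens n.
have n3 : (3 <= n)%N by exact: leq_maxr.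
have B2B : {subset B2 <= B} by move=> b /B2n0; exact/sub_wball/leq_maxl.
have [D {}cc] := cc B.
pose D' := 1%g :: D ++ T ++ C.
pose DD := [seq (d1 * d2)%g | d1 <- D', d2 <- D'].
(* The list of quotients of two-fold products is chosen so that its trivial intersection with [N] is
   the girth condition. *)
have [i [j [q [psi [trF qB qpsi adj]]]]] := cc [seq (a^-1 * b)%g | a <- DD, b <- DD].
have [DD' TD' CD'] : [/\ {subset D <= D'}, {subset T <= D'} & {subset C <= D'}].
  by split=> d dD; rewrite inE !mem_cat dD ?orbT.
pose M := heis_filtration i; pose N := cap_filtration heis_filtration heis_even j.
have nM : normal_subgroup M by case: heis_filtrationP => _ nM _ _; exact: nM.
have nN : normal_subgroup N by case: filN => _ nN _ _; exact: nN.
have D1 : 1%g \in D' by exact: mem_head.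
have girth d1 d2 d3 d4 : d1 \in D' -> d2 \in D' -> d3 \in D' -> d4 \in D' ->
    ((d1 * d2)^-1 * (d3 * d4))%g \in N -> (d1 * d2)%g = (d3 * d4)%g.
  move=> h1 h2 h3 h4 /trF eq1; apply/esym/(mulgI (d1 * d2)^-1%g).
  rewrite mulVg eq1//; apply/allpairsP; exists ((d1 * d2)%g, (d3 * d4)%g).
  by split=> //; apply/allpairsP; [exists (d1, d2) | exists (d3, d4)].
pose U e (h : subgroup heis_even) := heis_parities (3 ^ j) e (val h).
have qU e : quasi_invariant N (U e) by exact: heis_parities_quasi_invariant.
pose f e g g' := coset_diff D' (U e) (q (quot_pi M g)) (q (quot_pi M g')).
have qD' g b : b \in B -> qclose D' (q (quot_pi M g)) (q (quot_pi M (g * b)%g)).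
  by move=> bB; apply: (sub_qclose DD'); apply: qB; exact: qclose_pi.
(* The pulled back cocycle is integrated on the whole group, where no obstruction remains; [V e]
   need not descend to [quot M]. *)
have /choice[V VE] : forall e, exists V : heis -> bool,
    forall g b, b \in B -> f e g (g * b)%g = V g (+) V (g * b)%g.
  move=> e; apply: (heis_coboundary n3) => g b c bB cB bcB.
  apply: (coset_diff_cocycle nN D1 girth (qU e)); [exact: qD' | exact: qD' |].
  by rewrite -mulgA; exact: qD'.
(* Holonomy along x^(3^i) and y^(3^i), which measures the failure of [V e] to descend. It takes at
   most four values, so two of the eight triples share theirs. *)
pose hol e := (V e (heis_pt (3 ^ i)%N 0 0) (+) V e 1%g,
               V e (heis_pt 0 (3 ^ i)%N 0) (+) V e 1%g).
have /injectivePn[e [e' ee' hol_ee']] : ~~ injectiveb hol.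
  apply/negP => /injectiveP/leq_card; by rewrite !card_prod card_bool.
pose W g := V e g (+) V e' g.
pose U' h := U e h (+) U e' h.
have qU' : quasi_invariant N U'.
  by move=> m Nm k k'; rewrite /U' addbACA [RHS]addbACA
    (qU e _ Nm k k') (qU e' _ Nm k k').
have WE g b : b \in B ->
    coset_diff D' U' (q (quot_pi M g)) (q (quot_pi M (g * b)%g)) = W g (+) W (g * b)%g.
  by move=> bB; rewrite coset_diffD (VE e g b bB : coset_diff _ _ _ _ = _)
    (VE e' g b bB : coset_diff _ _ _ _ = _) addbACA.
pose chi m := W m (+) W 1%g.
(* [W] and its left translate by [m] are primitives of the same [M]-invariant cocycle, so they
   differ by a constant. *)
have Wchi m g : m \in M -> W (m * g)%g (+) W g = chi m.
  move=> Mm.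
  have := @generates_invariant _ _ _
    (fun g => W (m * g)%g (+) W g) heis_generated.
  rewrite /chi => ->; first by rewrite mulg1.
  move=> {}g s sg; have sB : s \in B.
    have := wball_letters (mem_letters sg).
    by apply: (sub_wball (leq_trans (isT : 1 <= 3)%N n3)).
  have := WE g s sB; have := WE (m * g)%g s sB.
  rewrite -mulgA !(quot_piMl nM _ Mm) => ->.
  by case: (W _); case: (W _); case: (W _); case: (W _).
(* Equal holonomies kill [chi] on x^(3^i) and y^(3^i), and the oddness of 3^i then kills it on all
   of [M], so [W] descends to [u]. *)
have chi0 m : m \in M -> chi m = false.
  case: hol_ee' => xE yE; apply: heis_cong_character (odd3X i) _ _ _ m.
  - move=> g h gM hM; have := Wchi _ h gM; rewrite /chi => <-.
    by case: (W _); case: (W _); case: (W _); case: (W _).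
  - by rewrite /chi /W addbACA xE addbb.
  - by rewrite /chi /W addbACA yE addbb.
have W_M g g' : quot_pi M g = quot_pi M g' -> W g' = W g.
  case/(quot_pi_lift nM) => m Mm ->.
  by have := Wchi m g Mm; rewrite chi0//; case: (W _); case: (W _).
pose u (x : quot M) := W (repr x).
have uE g : u (quot_pi M g) = W g by apply: W_M; rewrite quot_pi_repr.
(* The cocycle of [U'] has primitive [u] after pullback along [q], hence [u \o psi] after pullback
   along [q \o psi], which is close to the identity. *)
have U'N := @coset_diff_coboundary _ _ _ nN D1 girth _ qU' T C (q \o psi) (u \o psi)
  gT TD' CD' qpsi.
move: ee'; rewrite (_ : e = e') ?eqxx//.
pose d := (e.1.1 (+) e'.1.1, e.1.2 (+) e'.1.2, e.2 (+) e'.2).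
suff : d = (false, false, false).
  by rewrite /d; case: (e) (e') => [[[] []] []] [[[] []] []].
apply: (@heis_parities_inj (3 ^ j)); first by rewrite expn_gt0.
have UdE h : U d h = U' h.
  rewrite /U' /U /heis_parities /d /=.
  by do 3 case: (parity _); case: (e) (e') => [[[] []] []] [[[] []] []].
move=> g gq ge; pose h : subgroup heis_even := exist (fun g => g \in heis_even) g ge.
rewrite -/(U d h) UdE -[h]mulg1 U'N//.
  by rewrite /U' /U !val1 /heis_parities !div0z !andbF.
move=> y y' /adj; rewrite /=; elim/quot_piW: (psi y) => x.
move=> /(qcloseP nM)[b bB2 ->]; have bB := B2B _ bB2.
by split; [exact: qD' | rewrite WE// !uE].
Qed.

Theorem theorem1p13 (R : realType) :
  exists (G : groupType) (M : nat -> groupClosed G) (H : groupClosed G),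
    [/\ finitely_generated G /\ residually_finite G,
        filtration M,
        normal_subgroup H /\ finite_index H &
        forall (S : seq G) (T : seq (subgroup H)),
          generates S -> generates T ->
          ~ coarsely_equivalent
              (box_dist S R M)
              (box_dist T R (cap_filtration M H))].
Proof.
exists heis, heis_filtration, (heis_even : groupClosed heis); split.
- split; first by exists heis_gens; exact: heis_generated.
  exact: filtration_residually_finite heis_filtrationP.
- exact: heis_filtrationP.
- by split; [exact: heis_even_normal | exact: heis_even_finite_index].
- exact: heis_box_not_coarsely_equivalent.
Qed.
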